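(* There exists $N$ such that for every even integer $x\ge N$: if the set $\mathscr{A}(x)$ of divisibility events for $x$ is nearly independent, then $x$ can be expressed as the sum of two odd primes.
   Context: Write an even integer $x\ge 12$ as $x=12n+k$ with $n\ge 1$ and $k\in\{0,2,4,6,8,10\}$, and define the finite set $S$ (with $m$ ranging over integers) by: $k=0$: $S=\{12m+2:0\le m\le n-1\}\cup\{12m+10:0\le m\le n-1\}$; $k=2$ or $k=10$: $S=\{12m:1\le m\le n\}$; $k=4$: $S=\{12m+6:0\le m\le n-1\}$; $k=6$: $S=\{12m+4:0\le m\le n\}\cup\{12m+8:0\le m\le n-1\}$; $k=8$: $S=\{12m+6:0\le m\le n\}$. Equip $S$ with the uniform probability $P(E)=|E|/|S|$. Let $p_1=5<p_2=7<\cdots<p_r$ be the primes $p$ with $3<p<\sqrt{x}$, in increasing order. For each such $p$ let $A_p=\{y\in S: p\mid x+y\}\cup\{y\in S: p\mid x-y,\ x-y\neq 2p\}$. The set of divisibility events for $x$ is $\mathscr{A}(x)=\{A_{p_1},\ldots,A_{p_r}\}$ (in this order). For events $A,B$ let $\lambda(A,B)=\frac{P(B)-P(A\cap B)}{P(B)-P(A)P(B)}$. A (finite, ordered) collection of events $\{A_1,\ldots,A_r\}$ is called nearly independent if $\lambda_0<2.5$, where $\lambda_i=\lambda\big(\bigcup_{j=1}^{i-1}A_j,A_i\big)$ and $\lambda_0=\max\{\lambda_i: i=2,\ldots,r\}$ (the denominators being understood to be nonzero). *)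

(* Defs.v *)
From mathcomp Require Import all_boot all_order all_algebra.
From mathcomp Require Import finmap.

Set Implicit Arguments.
Unset Strict Implicit.
Unset Printing Implicit Defensive.

Import Order.TTheory GRing.Theory Num.Theory.

Local Open Scope fset_scope.
Local Open Scope ring_scope.

Section NearIndependence.

Variable S : {fset nat}.

(* Events are subsets of the sample space [S]. *)
Definition uprob (E : {fset nat}) : rat := #|` E|%:R / #|` S|%:R.

Definition dep_den (A B : {fset nat}) : rat := uprob B - uprob A * uprob B.

Definition dep_ratio (A B : {fset nat}) : rat :=
  (uprob B - uprob (A `&` B)) / dep_den A B.

(* Collections are lists, but events are numbered from 1: [event As i] is A_i
   for 1 <= i <= size As. *)
Definition event (As : seq {fset nat}) (i : nat) : {fset nat} :=
  nth fset0 As i.-1.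

Definition union_before (As : seq {fset nat}) (i : nat) : {fset nat} :=
  \big[fsetU/fset0]_(1 <= j < i) event As j.

Definition lambda_ (As : seq {fset nat}) (i : nat) : rat :=
  dep_ratio (union_before As i) (event As i).

(* The maximum of lambda_2, ..., lambda_r. The seed is lambda_2 itself, so for
   r >= 2 no extraneous value enters the maximum. *)
Definition lambda0 (As : seq {fset nat}) : rat :=
  \big[Num.max/lambda_ As 2]_(2 <= i < (size As).+1) lambda_ As i.

(* Division by zero is 0 in [rat], so the requirement that every lambda_i be
   defined has to be made explicit. *)
Definition lambdas_defined (As : seq {fset nat}) : Prop :=
  forall i : nat, (2 <= i <= size As)%N ->
    dep_den (union_before As i) (event As i) != 0.

Definition nearly_independent (As : seq {fset nat}) : Prop :=
  lambdas_defined As /\ lambda0 As < 5%:R / 2%:R.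

End NearIndependence.

(* [arith a lo hi] is {12 m + a : lo <= m < hi}. *)
Definition arith (a lo hi : nat) : {fset nat} :=
  [fset (12 * m + a)%N | m in index_iota lo hi].

(* The default branch is reached only for odd x. *)
Definition sample_space (x : nat) : {fset nat} :=
  let n := (x %/ 12)%N in
  match (x %% 12)%N with
  | 0 => arith 2 0 n `|` arith 10 0 n
  | 2 | 10 => arith 0 1 n.+1
  | 4 => arith 6 0 n
  | 6 => arith 4 0 n.+1 `|` arith 8 0 n
  | 8 => arith 6 0 n.+1
  | _ => fset0
  end.

(* The condition p < sqrt x is written p ^ 2 < x. *)
Definition sieve_primes (x : nat) : seq nat :=
  [seq p <- iota 0 x | [&& prime p, 3 < p & p ^ 2 < x]%N].

(* Every y in [sample_space x] satisfies y < x, so [x - y] is not truncated. *)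
Definition div_event (x p : nat) : {fset nat} :=
  [fset y in sample_space x | (p %| x + y)%N]
  `|` [fset y in sample_space x | (p %| x - y)%N && (x - y != 2 * p)%N].

Definition div_events (x : nat) : seq {fset nat} :=
  [seq div_event x p | p <- sieve_primes x].

(* Main.v *)
Require Import Defs.
From mathcomp Require Import all_boot all_order all_algebra.
From mathcomp Require Import finmap.
From mathcomp Require Import zify ring lra.

(** For [y] in the sample space [S], write [x = P + Q] with [P = (x + y) / 2]
    and [Q = (x - y) / 2]. The residues modulo 12 defining [S] make [P] and [Q]
    coprime to 6. If [y] avoids every divisibility event, then [P] has no prime
    factor below [sqrt x], and [Q] has none except possibly [Q] itself. Hence
    both are prime, unless [y = x - 2] and [Q = 1] ([unsieved_goldbach]). So it
    suffices that at least two points of [S] avoid all the events.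

    Near independence plays the role of a sieve bound: [lambda_i < 5/2] says
    that the [i]-th event removes at most the fraction [5/2 * P(A_i)] of what
    the earlier events leave ([nearly_independent_compl_ge]). Counting residues
    gives [P(A_p) <= 2 / p + 4 / #|S|] ([card_div_event]), which is at most
    [11 / (5 * p)] for large [x] because [p < sqrt x]. The first event removes
    at most half of [S], and each later one multiplies the remainder by at least
    [1 - 11 / (2 * p)].

    No information on the density of the primes is needed to bound the product
    of these factors. Enlarge the set of primes from 7 to [sqrt x] to all
    integers that are 1 or 5 modulo 6: with [t] close to [sqrt x / 6], the sum
    of [11 / (2 * j)] over these integers [j] is about [11/6 * log t], so the
    product decays like [t ^ (- 11/6)], whereas [#|S|] grows at least like
    [2 * t ^ 2]. The product therefore leaves on the order of [t ^ (1/6)] points.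
    A lower bound of order [t ^ (1/12)], proved by a telescoping estimate
    ([sieve_prod_growth]), is already unbounded. *)

Set Implicit Arguments.
Unset Strict Implicit.
Unset Printing Implicit Defensive.

Import Order.TTheory GRing.Theory Num.Theory.

Local Open Scope fset_scope.
Local Open Scope nat_scope.

(** * Counting the points of a divisibility event *)

Lemma mem_arith a lo hi y :
  (y \in arith a lo hi) = [&& y %% 12 == a %% 12, 12 * lo + a <= y & y < 12 * hi + a].
Proof.
apply/imfsetP/idP => [[m /=]|H].
  by rewrite mem_index_iota => Hm ->; lia.
exists ((y - a) %/ 12) => /=; rewrite ?mem_index_iota; lia.
Qed.

Lemma card_arith a lo hi : #|` arith a lo hi| = hi - lo.
Proof.
rewrite card_imfset /=; last by move=> m n; lia.
by rewrite undup_id ?size_iota ?iota_uniq.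
Qed.

(** The elements are determined by their quotients by [M], counted from [c]:
    two of them in the same block of [M] consecutive integers would be equal. *)
Lemma card_congruent (E : {fset nat}) (c L M : nat) :
  0 < M -> {in E, forall y, c <= y < c + L} ->
  {in E &, forall y z, y = z %[mod M]} ->
  #|` E| <= (L %/ M).+1.
Proof.
move=> M0 EL EM; set f := fun y => (y - c) %/ M.
have inj_f : {in E &, injective f}.
  move=> y z yE zE eq_f.
  have /andP[cy _] := EL _ yE; have /andP[cz _] := EL _ zE.
  have := EM _ _ yE zE; rewrite -(subnKC cy) -(subnKC cz) => /eqP.
  rewrite eqn_modDl => /eqP eq_m.
  by rewrite (divn_eq (y - c) M) (divn_eq (z - c) M) eq_m -/(f y) eq_f.
rewrite -(size_map f) -(size_iota 0 (L %/ M).+1).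
apply: uniq_leq_size.
  by rewrite map_inj_in_uniq // fset_uniq.
move=> _ /mapP[y yE ->]; rewrite mem_iota add0n ltnS /=.
by apply: leq_div2r; have := EL _ yE; lia.
Qed.

(** Inside one class modulo 12, congruence modulo [p] is congruence modulo
    [12 * p], so it is the number of terms that gets divided by [p]. *)
Lemma card_congruent_arith (E : {fset nat}) (a lo hi p : nat) :
  coprime 12 p -> E `<=` arith a lo hi ->
  {in E &, forall y z, y = z %[mod p]} ->
  #|` E| <= ((hi - lo) %/ p).+1.
Proof.
move=> co12 /fsubsetP sE Ep.
have p0 : 0 < p by case: p co12 {Ep}.
rewrite -(@divnMl 12) //; apply: (@card_congruent E (12 * lo + a)).
- by rewrite muln_gt0.
- by move=> y /sE; rewrite mem_arith; lia.
move=> y z yE zE; apply/eqP; rewrite chinese_remainder // (Ep y z) // eqxx andbT.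
by move: (sE _ yE) (sE _ zE); rewrite !mem_arith => /andP[/eqP-> _] /andP[/eqP-> _].
Qed.

(** Every case of the sample space is put in one shape, so that the events need
    be counted only once; the second progression may be empty. *)
Lemma sample_space_two_progressions x : 12 <= x -> ~~ odd x ->
  exists a lo hi b lo' hi',
    [/\ sample_space x = arith a lo hi `|` arith b lo' hi',
        #|` sample_space x| = (hi - lo) + (hi' - lo')
      & x %/ 12 <= #|` sample_space x|].
Proof.
move=> x12 ev; set n := x %/ 12.
set concl := ex _.
have one a lo hi : sample_space x = arith a lo hi -> n <= hi - lo -> concl.
  move=> eqS nle; rewrite /concl eqS; exists a, lo, hi, 0, 0, 0.
  rewrite card_arith addn0; split=> //.
  by apply/fsetP=> y; rewrite inE !mem_arith; lia.
have two a lo hi b lo' hi' : sample_space x = arith a lo hi `|` arith b lo' hi' ->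
    a %% 12 != b %% 12 -> n <= hi - lo -> concl.
  move=> eqS ab nle; rewrite /concl eqS; exists a, lo, hi, b, lo', hi'.
  have dis : arith a lo hi `&` arith b lo' hi' = fset0.
    by apply/fsetP=> y; rewrite !inE !mem_arith; apply/negP; lia.
  by rewrite cardfsU dis cardfs0 subn0 !card_arith; split=> //; lia.
have : x %% 12 \in [:: 0; 2; 4; 6; 8; 10] by rewrite !inE; lia.
rewrite !inE => /or4P[/eqP k|/eqP k|/eqP k|/or3P[]/eqP k].
- by apply: (two 2 0 n 10 0 n); rewrite ?subn0 // /sample_space k.
- by apply: (one 0 1 n.+1); rewrite ?subn1 // /sample_space k.
- by apply: (one 6 0 n); rewrite ?subn0 // /sample_space k.
- by apply: (two 4 0 n.+1 8 0 n); rewrite ?subn0 // /sample_space k.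
- by apply: (one 6 0 n.+1); rewrite ?subn0 // /sample_space k.
- by apply: (one 0 1 n.+1); rewrite ?subn1 // /sample_space k.
Qed.

(** The residues defining the sample space are those for which neither 2 nor 3
    divides [P = (x + y) / 2] or [Q = (x - y) / 2]. *)
Lemma sample_space_half_sum_diff x y : 12 <= x -> ~~ odd x -> y \in sample_space x ->
  exists P Q, [/\ x = P + Q, P = Q + y, 0 < Q, coprime 6 P & coprime 6 Q].
Proof.
move=> x12 ev.
have co6 m : (m %% 6 == 1) || (m %% 6 == 5) -> coprime 6 m.
  by rewrite -coprime_modr => /orP[]/eqP->.
suff main : y \in sample_space x ->
  [&& y < x, ~~ odd y, ((x + y)./2 %% 6 == 1) || ((x + y)./2 %% 6 == 5)
    & ((x - y)./2 %% 6 == 1) || ((x - y)./2 %% 6 == 5)].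
  move/main => /and4P[yx oy /co6 cP /co6 cQ].
  by exists (x + y)./2, (x - y)./2; split=> //; lia.
rewrite /sample_space.
have : x %% 12 \in [:: 0; 2; 4; 6; 8; 10] by rewrite !inE; lia.
rewrite !inE => /or4P[/eqP k|/eqP k|/eqP k|/or3P[]/eqP k];
  rewrite k ?in_fsetU !mem_arith; lia.
Qed.

(** Each of the two divisibility conditions fixes [y] modulo [p], hence keeps at
    most [L / p + 1] points of a progression of length [L]; there are two
    conditions and at most two progressions. *)
Lemma card_div_event x p : 12 <= x -> ~~ odd x -> coprime 12 p ->
  p * #|` div_event x p| <= 2 * #|` sample_space x| + 4 * p.
Proof.
move=> x12 ev co12.
have [a [lo [hi [b [lo' [hi' [eqS -> _]]]]]]] := sample_space_two_progressions x12 ev.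
pose E1 := [fset y in sample_space x | p %| x + y].
pose E2 := [fset y in sample_space x | (p %| x - y) && (x - y != 2 * p)].
have E1p : {in E1 &, forall y z, y = z %[mod p]}.
  move=> y z; rewrite !inE /= => /andP[_ py] /andP[_ pz].
  apply/eqP; rewrite -(eqn_modDl x); move: py pz.
  by rewrite /dvdn => /eqP-> /eqP->.
have E2p : {in E2 &, forall y z, y = z %[mod p]}.
  have E2x y : y \in E2 -> x = y %[mod p].
    rewrite !inE /= => /and3P[yS py _].
    have [P [Q [xPQ PQy _ _ _]]] := sample_space_half_sum_diff x12 ev yS.
    by apply/eqP; rewrite eqn_mod_dvd //; lia.
  by move=> y z /E2x <- /E2x <-.
have cardE (E : {fset nat}) : E `<=` sample_space x ->
    {in E &, forall y z, y = z %[mod p]} ->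
    #|` E| <= ((hi - lo) %/ p).+1 + ((hi' - lo') %/ p).+1.
  move=> sE Ep.
  have -> : E = (E `&` arith a lo hi) `|` (E `&` arith b lo' hi').
    by rewrite -fsetIUr -eqS; apply/esym/fsetIidPl.
  rewrite cardfsU; apply: leq_trans (leq_subr _ _) _.
  apply: leq_add; [apply: (@card_congruent_arith _ a)|apply: (@card_congruent_arith _ b)].
  all: rewrite ?fsubsetIr //.
  - by move=> y z; rewrite !inE => /andP[yE _] /andP[zE _]; apply: Ep.
  - by move=> y z; rewrite !inE => /andP[yE _] /andP[zE _]; apply: Ep.
have c1 : #|` E1| <= _ := cardE _ (fset_sub _ _) E1p.
have c2 : #|` E2| <= _ := cardE _ (fset_sub _ _) E2p.
have cU : #|` div_event x p| <= #|` E1| + #|` E2|.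
  by rewrite /div_event -/E1 -/E2 cardfsU leq_subr.
have := leq_trunc_div (hi - lo) p; have := leq_trunc_div (hi' - lo') p.
nia.
Qed.

(** * From a surviving point to a sum of two primes *)

Lemma mem_sieve_primes x p :
  (p \in sieve_primes x) = [&& prime p, 3 < p & p ^ 2 < x].
Proof.
rewrite mem_filter mem_iota andb_idr // => /and3P[_ _ px].
by rewrite /= add0n; apply: leq_ltn_trans px; rewrite -mulnn; nia.
Qed.

(** The least prime factor of a composite number [P < x] has its square below
    [x], so it is one of the sieving primes. *)
Lemma prime_of_sieved x P : 1 < P < x -> coprime 6 P ->
  {in sieve_primes x, forall p, p %| P -> p = P} -> prime P.
Proof.
move=> /andP[P1 Px] co6 sieved.
have p_pr := pdiv_prime P1; have pP := pdiv_dvd P.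
case: (ltnP P (pdiv P ^ 2)) => [|sq]; first by apply: ltn_pdiv2_prime; lia.
rewrite -(sieved (pdiv P)) // mem_sieve_primes p_pr (leq_ltn_trans sq Px) andbT /=.
have : coprime 6 (pdiv P) := coprime_dvdr pP co6.
by move: (pdiv P) p_pr => [|[|[|[|q]]]].
Qed.

(** A surviving [y] gives the decomposition [x = (x + y) / 2 + (x - y) / 2]. The
    clause [x - y != 2 * p] in the events exempts the half difference that is
    itself a sieving prime; the point [y = x - 2], whose half difference is 1,
    may pass the sieve and is excluded here. *)
Lemma unsieved_goldbach x y : 12 <= x -> ~~ odd x ->
  y \in sample_space x -> x - y != 2 ->
  {in sieve_primes x, forall p, y \notin div_event x p} ->
  exists p q, [/\ prime p, odd p, prime q, odd q & x = p + q].
Proof.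
move=> x12 ev yS xy2 unsieved.
have [P [Q [xPQ PQy Q0 coP coQ]]] := sample_space_half_sum_diff x12 ev yS.
have odd6 m : coprime 6 m -> odd m.
  by move=> co6; rewrite -coprime2n; apply: coprime_dvdl co6.
have dP p : p \in sieve_primes x -> ~~ (p %| P).
  move/unsieved; rewrite in_fsetU !inE yS /= negb_or => /andP[+ _].
  by apply: contra => pP; rewrite (_ : x + y = P * 2) ?dvdn_mulr //; lia.
have dQ p : p \in sieve_primes x -> p %| Q -> p = Q.
  move/unsieved; rewrite in_fsetU !inE yS /= negb_or => /andP[_].
  rewrite (_ : x - y = Q * 2); last by lia.
  by move=> + pQ; rewrite dvdn_mulr //=; lia.
exists P, Q; split; rewrite ?odd6 //.
  apply: (@prime_of_sieved x) => //; first lia.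
  by move=> p /dP/negP.
by apply: (@prime_of_sieved x) => //; lia.
Qed.

Local Open Scope ring_scope.

(** * Products of factors in the unit interval *)

Lemma prodr_seq_ge0 (R : numDomainType) (I : eqType) (r : seq I) (f : I -> R) :
  {in r, forall i, 0 <= f i} -> 0 <= \prod_(i <- r) f i.
Proof. by move=> f0; rewrite big_seq prodr_ge0. Qed.

Lemma prod_le_sub (R : numDomainType) (I : eqType) (r s : seq I) (f : I -> R) :
  uniq r -> uniq s -> {subset s <= r} -> {in r, forall i, 0 <= f i <= 1} ->
  \prod_(i <- r) f i <= \prod_(i <- s) f i.
Proof.
move=> ur us sub f01.
rewrite (bigID (mem s)) /=.
have -> : \prod_(i <- s) f i = \prod_(i <- r | i \in s) f i.
  rewrite -(big_filter r); apply/perm_big/uniq_perm; rewrite ?filter_uniq // => i.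
  by rewrite mem_filter andb_idr //; apply: sub.
rewrite ler_piMr //.
  by rewrite big_seq_cond prodr_ge0 // => i /andP[/f01/andP[]].
by rewrite big_seq_cond; apply: prodr_ile1 => i /andP[/f01].
Qed.

(** * Near independence as a sieve inequality *)

Lemma uprobU S A B :
  uprob S (A `|` B) = uprob S A + uprob S B - uprob S (A `&` B).
Proof.
apply/eqP; rewrite -(subr_eq _ _ (- _)) opprK /uprob -!mulrDl -!natrD.
by rewrite cardfsUI.
Qed.

(** Multiplied by its denominator [P(B) * (1 - P(A)) > 0], the bound on the ratio
    says that at most [5/2 * P(B) * (1 - P(A))] of the complement of [A] lies in
    [B]. *)
Lemma uprob_complU_ge S A B :
  dep_den S A B != 0 -> dep_ratio S A B < 5%:R / 2%:R -> uprob S A <= 1 ->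
  (1 - uprob S A) * (1 - 5%:R / 2%:R * uprob S B) <= 1 - uprob S (A `|` B).
Proof.
have PB0 : 0 <= uprob S B by rewrite divr_ge0.
rewrite uprobU /dep_ratio => den0 + PA1.
have den_gt0 : 0 < dep_den S A B by rewrite lt0r den0 /dep_den; nra.
by rewrite ltr_pdivrMr // /dep_den; lra.
Qed.

(** Each event after the first removes at most the fraction [5/2 * P(B)] of what
    is left; the hypothesis [P(B) <= 2/5] keeps these factors nonnegative. *)
Lemma nearly_independent_compl_ge S A As :
  nearly_independent S (A :: As) -> uprob S A <= 1 ->
  {in As, forall B, uprob S B <= 2%:R / 5%:R} ->
  (1 - uprob S A) * \prod_(B <- As) (1 - 5%:R / 2%:R * uprob S B)
    <= 1 - uprob S (\bigcup_(B <- A :: As) B).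
Proof.
move=> [defd max_lt] PA1 PAs.
pose F B := 1 - 5%:R / 2%:R * uprob S B.
have F0 i : (i < size As)%N -> 0 <= F (nth fset0 As i).
  by move=> ilt; have := PAs _ (mem_nth fset0 ilt); rewrite /F; lra.
have lam_lt i : (2 <= i <= (size As).+1)%N -> lambda_ S (A :: As) i < 5%:R / 2%:R.
  move=> ile; apply: le_lt_trans max_lt; apply: le_bigmax_seq => //.
  by rewrite mem_index_iota /= ltnS.
suff main k : (k <= size As)%N ->
    (1 - uprob S A) * \prod_(0 <= i < k) F (nth fset0 As i)
      <= 1 - uprob S (union_before (A :: As) k.+2).
  have := main _ (leqnn _); rewrite -(big_nth fset0 xpredT F) /union_before.
  by rewrite big_add1 /= [\bigcup_(B <- A :: As) B](big_nth fset0).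
elim: k => [_|k IHk lk].
  by rewrite /union_before big_nat1 big_geq // mulr1.
rewrite /union_before big_nat_recr //= -/(union_before (A :: As) k.+2).
rewrite big_nat_recr //= mulrA.
have prod0 : 0 <= \prod_(0 <= i < k) F (nth fset0 As i).
  apply: prodr_seq_ge0 => i; rewrite mem_index_iota => /andP[_ ik].
  exact/F0/(ltn_trans ik).
have := IHk (ltnW lk); set U := union_before _ _ => IH.
have := @uprob_complU_ge S U (event (A :: As) k.+2); rewrite -/(F _) => step.
apply: le_trans (step _ _ _); last first.
- rewrite -subr_ge0; apply: le_trans IH; apply: mulr_ge0 prod0.
  by rewrite subr_ge0.
- exact: (lam_lt k.+2).
- exact: (defd k.+2).
exact: ler_wpM2r (F0 _ lk) _ _ IH.
Qed.

(** * The product of the sieve factors *)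

(** With [P(A_p) <= 11 / (5 * p)] as the bound for an event, this is
    [1 - 5/2 * P(A_p)]. *)
Definition sieve_factor (R : realFieldType) (j : nat) : R := 1 - 11%:R / (2 * j)%:R.

(** The bound [6 * t + 7] makes one step in [t] cover exactly one pair of
    residues 1 and 5 modulo 6. *)
Definition sieve_prod (R : realFieldType) (t : nat) : R :=
  \prod_(7 <= j < 6 * t + 7 | prime j) sieve_factor R j.

Lemma sieve_factor_itv (R : realFieldType) j : (6 <= j)%N -> 0 <= sieve_factor R j <= 1.
Proof.
move=> j6; rewrite /sieve_factor.
have j0 : 0 < (2 * j)%:R :> R by rewrite ltr0n; lia.
rewrite subr_ge0 ler_pdivrMr // mul1r ler_nat gerBl divr_ge0 // andbT; lia.
Qed.

Lemma sieve_prod_ge0 (R : realFieldType) t : 0 <= sieve_prod R t.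
Proof.
rewrite /sieve_prod -big_filter; apply: prodr_seq_ge0 => j.
rewrite mem_filter mem_index_iota => /and3P[_ j7 _].
by have /andP[] := sieve_factor_itv R (ltnW j7).
Qed.

(** A prime above 3 is 1 or 5 modulo 6, and including a composite factor only
    makes the product smaller. *)
Lemma sieve_prodS (R : realFieldType) t :
  sieve_prod R t * (sieve_factor R (6 * t + 7) * sieve_factor R (6 * t + 11))
    <= sieve_prod R t.+1.
Proof.
rewrite /sieve_prod (@big_cat_nat _ _ _ (6 * t + 7) 7 (6 * t.+1 + 7)) /=; try lia.
rewrite ler_wpM2l ?sieve_prod_ge0 //.
have -> : sieve_factor R (6 * t + 7) * sieve_factor R (6 * t + 11) =
   \prod_(j <- [:: 6 * t + 7; 6 * t + 11]%N) sieve_factor R j.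
  by rewrite !big_cons big_nil mulr1.
rewrite -[leRHS]big_filter; apply: prod_le_sub.
- by rewrite /= inE andbT; lia.
- by rewrite filter_uniq ?iota_uniq.
- move=> j; rewrite mem_filter mem_index_iota !inE => /and3P[jp j_ge j_lt].
  have n2 : ~~ (2 %| j)%N by rewrite dvdn_prime2 //; lia.
  have n3 : ~~ (3 %| j)%N by rewrite dvdn_prime2 //; lia.
  lia.
by move=> j; rewrite !inE => /orP[]/eqP->; apply: sieve_factor_itv; lia.
Qed.

Lemma bernoulli_ge (R : realFieldType) (x : R) n : 0 <= x -> 1 + n%:R * x <= (1 + x) ^+ n.
Proof.
move=> x0; elim: n => [|n IHn]; first by rewrite mul0r addr0.
rewrite exprS; apply: le_trans (_ : (1 + x) * (1 + n%:R * x) <= _).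
  have n0 : 0 <= n%:R :> R by [].
  by rewrite -natr1; nra.
by rewrite ler_wpM2l //; lra.
Qed.

(** One step multiplies the product by about [1 - 11 / (6 * t)] and [t ^ 2] by
    about [1 + 2 / t]. The difference leaves room for a factor
    [1 + 1 / (12 * t)], whose twelfth power is at least [(t + 1) / t] by
    Bernoulli, and these quotients telescope. *)
Lemma sieve_prod_growth (R : realFieldType) t : (0 < t)%N ->
  (3%:R / 28%:R) ^+ 12 * t%:R <= (t%:R ^+ 2 * sieve_prod R t) ^+ 12.
Proof.
elim: t => [//|[|t] IHt] _.
  have := sieve_prodS R 0; rewrite {1}/sieve_prod big_geq // expr1n mulr1 !mul1r.
  (* 3/28 is the product of the factors at 7 and 11. *)
  move=> G1; rewrite ler_pXn2r ?nnegrE ?sieve_prod_ge0 //.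
    apply: le_trans G1; rewrite /sieve_factor.
    by rewrite -[(2 * (6 * 0 + 7))%N]/14%N -[(2 * (6 * 0 + 11))%N]/22%N; lra.
  by lra.
set u := t.+1%:R : R; set W := u ^+ 2 * sieve_prod R t.+1.
have u1 : 1 <= u by rewrite ler1n.
have W0 : 0 <= W by rewrite mulr_ge0 ?sieve_prod_ge0 // exprn_ge0 //; lra.
have step : W * (1 + (12%:R * u)^-1) <= t.+2%:R ^+ 2 * sieve_prod R t.+2.
  apply: le_trans (_ : t.+2%:R ^+ 2 * (sieve_prod R t.+1 *
    (sieve_factor R (6 * t.+1 + 7) * sieve_factor R (6 * t.+1 + 11))) <= _); last first.
    by rewrite ler_wpM2l ?sieve_prodS // exprn_ge0.
  rewrite [leRHS]mulrCA /W [u ^+ 2 * _]mulrC -mulrA ler_wpM2l ?sieve_prod_ge0 //.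
  rewrite /sieve_factor !(natrM, natrD) -(natr1 t.+1) -/u -subr_ge0.
  have -> : (u + 1) ^+ 2 * ((1 - 11%:R / (2 * (6 * u + 7))) *
      (1 - 11%:R / (2 * (6 * u + 11)))) - u ^+ 2 * (1 + (12 * u)^-1)
     = (144 * u ^+ 3 + 2028 * u ^+ 2 + 2500 * u + 396) /
       (12 * (2 * (6 * u + 7)) * (2 * (6 * u + 11))) :> R.
    by field; rewrite !andbA -!andbA; do ?[apply/andP; split]; lra.
  by apply: divr_ge0; nra.
apply: le_trans (_ : (W * (1 + (12%:R * u)^-1)) ^+ 12 <= _); last first.
  apply: lerXn2r step; rewrite nnegrE.
    by rewrite mulr_ge0 // addr_ge0 // invr_ge0; lra.
  by rewrite mulr_ge0 ?sieve_prod_ge0 ?exprn_ge0.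
rewrite [leRHS]exprMn -(natr1 t.+1) -/u.
have -> : u + 1 = u * (1 + u^-1) by field; lra.
rewrite mulrA; apply: ler_pM.
- by rewrite mulr_ge0 ?exprn_ge0 //; lra.
- by rewrite addr_ge0 // invr_ge0; lra.
- exact: IHt.
have := @bernoulli_ge R (12%:R * u)^-1 12; rewrite invr_ge0.
have -> : 12%:R * (12%:R * u)^-1 = u^-1 by field; lra.
by apply; lra.
Qed.

(** Already the weak growth of [t ^ 2 * sieve_prod t] suffices: its twelfth power
    exceeds a positive multiple of [t]. *)
Lemma sieve_prod_gt (R : archiRealFieldType) :
  exists t0, forall t, (t0 <= t)%N -> 1 < t%:R ^+ 2 * sieve_prod R t.
Proof.
pose c : R := (3%:R / 28%:R) ^+ 12.
have c0 : 0 < c by rewrite exprn_gt0 // divr_gt0.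
exists (Num.bound c^-1).+1 => t t0t.
have ct : 1 < c * t%:R.
  rewrite -ltr_pdivrMl // mulr1.
  apply: lt_le_trans (_ : (Num.bound c^-1)%:R <= _); last by rewrite ler_nat ltnW.
  by apply: archi_boundP; rewrite invr_ge0 ltW.
have W0 : 0 <= t%:R ^+ 2 * sieve_prod R t by rewrite mulr_ge0 ?sieve_prod_ge0 ?exprn_ge0.
rewrite ltNge; apply/negP => W1; have := exprn_ile1 12 W0 W1; apply/negP; rewrite -ltNge.
exact: lt_le_trans ct (sieve_prod_growth R (leq_ltn_trans (leq0n _) t0t)).
Qed.

(** * Many points survive *)

Lemma event_bound_antitone (R : realFieldType) m p : (0 < m <= p)%N ->
  11%:R / (5 * p)%:R <= 11%:R / (5 * m)%:R :> R.
Proof.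
move=> /andP[m0 mp]; have p0 := leq_trans m0 mp.
by rewrite ler_pM2l ?ltr0n // lef_pV2 ?posrE ?ltr0n ?muln_gt0 // ler_nat leq_mul2l.
Qed.

Lemma sieve_factorE (R : realFieldType) j : (0 < j)%N ->
  sieve_factor R j = 1 - 5%:R / 2%:R * (11%:R / (5 * j)%:R).
Proof.
rewrite -(ltr0n R) /sieve_factor !natrM => j0.
by congr (1 - _); field; lra.
Qed.

(** The counting bound is [2 / p + 4 / #|S|], and its second term is at most
    [1 / (5 * p)] because [#|S|] is at least [x %/ 12]. *)
Lemma uprob_div_event_le x p : (12 <= x)%N -> ~~ odd x -> coprime 12 p ->
  (20 * p <= x %/ 12)%N ->
  uprob (sample_space x) (div_event x p) <= 11%:R / (5 * p)%:R.
Proof.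
move=> x12 ev co12 p_small.
have [_ [_ [_ [_ [_ [_ [_ _ nS]]]]]]] := sample_space_two_progressions x12 ev.
have cA := card_div_event x12 ev co12.
have p0 : (0 < p)%N by case: p co12 {p_small cA}.
have S0 : (0 < #|` sample_space x|)%N by lia.
rewrite /uprob ler_pdivrMr; last by rewrite ltr0n.
rewrite mulrAC ler_pdivlMr; last by rewrite ltr0n muln_gt0.
rewrite -!natrM ler_nat; lia.
Qed.

(** Choosing [t] of size [sqrt x / 6] serves twice: the sieving primes lie below
    [6 * t + 7], and the sample space has at least [2 * t ^ 2] points. The factor
    2 absorbs the loss of at most one half due to the first event, for which
    near independence gives no information. *)
Lemma surviving_points x t :
  (12 <= x)%N -> ~~ odd x -> (36 * t ^ 2 <= x < 36 * t.+1 ^ 2)%N -> (61 <= t)%N ->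
  nearly_independent (sample_space x) (div_events x) ->
  t%:R ^+ 2 * sieve_prod rat t <=
    #|` sample_space x `\` \bigcup_(A <- div_events x) A|%:R.
Proof.
move=> x12 ev /andP[tx xt] t61.
set S := sample_space x.
have [_ [_ [_ [_ [_ [_ [_ _ nS]]]]]]] := sample_space_two_progressions x12 ev.
rewrite -/S in nS.
have n_ge : (2 * t ^ 2 <= x %/ 12)%N by rewrite leq_divRL //; lia.
have p_lt p : p \in sieve_primes x -> (p < 6 * t + 7)%N.
  by rewrite mem_sieve_primes => /and3P[_ _ px]; nia.
have P_le p : p \in sieve_primes x -> uprob S (div_event x p) <= 11%:R / (5 * p)%:R.
  move=> ps; apply: uprob_div_event_le => //.
    move: ps; rewrite mem_sieve_primes => /and3P[pp p3 _].
    rewrite coprime_sym prime_coprime // -[12%N]/(2 * 2 * 3)%N !Euclid_dvdM //.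
    by rewrite !dvdn_prime2 //; lia.
  (* 61 is the least t with 20 * (6 * t + 6) <= 2 * t ^ 2. *)
  have := p_lt _ ps; nia.
have us : uniq (sieve_primes x) by rewrite filter_uniq ?iota_uniq.
have sorteds : sorted ltn (sieve_primes x).
  by rewrite sorted_filter ?iota_ltn_sorted //; apply: ltn_trans.
have x5 : 5 \in sieve_primes x by rewrite mem_sieve_primes /=; nia.
rewrite /div_events; case def_ps: (sieve_primes x) => [|q ps] in x5 us sorteds *.
  by [].
rewrite /= => /nearly_independent_compl_ge main.
have qs : q \in sieve_primes x by rewrite def_ps mem_head.
have q5 : (4 < q)%N.
  move: qs; rewrite mem_sieve_primes => /and3P[+ q3 _].
  by rewrite ltn_neqAle q3 andbT; apply: contraTneq => <-.
have pss p : p \in ps -> [/\ p \in sieve_primes x, prime p & 6 < p < 6 * t + 7]%N.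
  move=> pps; have ps' : p \in sieve_primes x by rewrite def_ps inE pps orbT.
  split=> //; first by move: ps'; rewrite mem_sieve_primes => /and3P[].
  rewrite p_lt // andbT.
  have : (q < p)%N.
    move: sorteds; rewrite /= path_sortedE; last exact: ltn_trans.
    by move=> /andP[/allP/(_ _ pps)].
  move=> /(leq_ltn_trans q5) p5; rewrite ltn_neqAle p5 andbT.
  by move: ps'; rewrite mem_sieve_primes => /andP[+ _]; apply: contraTneq => <-.
have Pq : uprob S (div_event x q) <= 1 / 2%:R.
  have := P_le _ qs; have := @event_bound_antitone rat 5 q q5.
  by rewrite (natrM _ 5 5); lra.
have Pps p : p \in ps -> uprob S (div_event x p) <= 2%:R / 5%:R.
  move=> /pss[p_s _ /andP[p7 _]]; apply: le_trans (P_le _ p_s) _.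
  by have := @event_bound_antitone rat 7 p p7; rewrite (natrM _ 5 7); lra.
have {main} main : 1 / 2%:R * sieve_prod rat t <=
    1 - uprob S (\bigcup_(B <- div_event x q :: [seq div_event x p | p <- ps]) B).
  apply: le_trans (main _ _); last 2 first.
  - by lra.
  - by move=> _ /mapP[p pps ->]; apply: Pps.
  apply: ler_pM; [lra|exact: sieve_prod_ge0|lra|].
  rewrite big_map /sieve_prod -big_filter.
  apply: le_trans (_ : \prod_(p <- ps) sieve_factor rat p <= _).
    apply: prod_le_sub; rewrite ?filter_uniq ?iota_uniq //.
    - by move: us => /andP[].
    - by move=> p /pss[_ pp p_itv]; rewrite mem_filter pp mem_index_iota.
    move=> p; rewrite mem_filter mem_index_iota => /and3P[_ p7 _].
    exact/sieve_factor_itv/ltnW.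
  rewrite !big_seq; apply: ler_prod => p /pss[p_s _ /andP[p7 _]].
  have /andP[-> _] := sieve_factor_itv rat (ltnW p7).
  rewrite (sieve_factorE _ (ltnW (ltnW (ltnW (ltnW (ltnW (ltnW p7))))))).
  by have := P_le _ p_s; lra.
set U := \bigcup_(_ <- _) _ in main *.
have S0 : 0 < #|` S|%:R :> rat by rewrite ltr0n; lia.
have cardSU : #|` S|%:R - #|` U|%:R <= #|` S `\` U|%:R :> rat.
  rewrite lerBlDr -natrD ler_nat -(cardfsID U S) addnC leq_add2l.
  by apply/fsubset_leq_card/fsubsetIr.
apply: le_trans cardSU; move: main; rewrite /uprob.
rewrite -(ler_pM2l S0) mulrBr mulr1 [_ * (_ / _)]mulrC divfK; last by rewrite gt_eqF.
apply: le_trans; rewrite mulrA; apply: ler_wpM2r; first exact: sieve_prod_ge0.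
have : (2 * t ^ 2)%:R <= #|` S|%:R :> rat by rewrite ler_nat (leq_trans n_ge).
by rewrite natrM natrX; lra.
Qed.

Theorem theorem6p10 :
  exists N : nat, forall x : nat,
    (N <= x)%N -> (12 <= x)%N -> ~~ odd x ->
    nearly_independent (sample_space x) (div_events x) ->
    exists p q : nat,
      [/\ prime p, odd p, prime q, odd q & x = (p + q)%N].
Proof.
have [t0 W_gt1] := sieve_prod_gt rat.
exists (36 * maxn 61 t0 ^ 2)%N => x Nx x12 ev indep.
have exP : exists t, (36 * t ^ 2 <= x)%N by exists (maxn 61 t0).
have ubP t : (36 * t ^ 2 <= x)%N -> (t <= x)%N by rewrite -mulnn; nia.
case: (ex_maxnP exP ubP) => t tx t_max.
have /andP[t61 tt0] : (61 <= t)%N && (t0 <= t)%N by rewrite -geq_max t_max.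
have xt : (x < 36 * t.+1 ^ 2)%N by rewrite ltnNge; apply/negP => /t_max; rewrite ltnn.
have := surviving_points x12 ev _ t61 indep; rewrite tx xt => /(_ isT).
set V := _ `\` _ => V_ge.
have V_gt1 : (1 < #|` V|)%N by have := lt_le_trans (W_gt1 t tt0) V_ge; rewrite ltr1n.
(* Two survivors are needed, as one of them may be the spurious point x - 2. *)
have /fset0Pn[y] : V `\ (x - 2)%N != fset0.
  rewrite -cardfs_gt0; have := leq_b1 ((x - 2)%N \in V).
  by move: V_gt1; rewrite (cardfsD1 (x - 2)%N V); lia.
rewrite !inE => /and3P[yx2 yU yS].
apply: (unsieved_goldbach x12 ev yS).
  by have [P [Q [? ? ? _ _]]] := sample_space_half_sum_diff x12 ev yS; lia.
move=> p ps; apply: contra yU => yA; apply/bigfcupP; exists (div_event x p) => //.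
by rewrite andbT; apply: map_f.
Qed.
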